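(* Let $G$ be an infinite connected simple graph with bounded degrees that is uniformly weakly recurrent. Assume that for some $d>1$, $G$ is Ahlfors $d$-regular and satisfies the sub-Gaussian heat kernel upper bounds with walk dimension $d$. Then for every $x\in V(G)$, $$\liminf_{n\to\infty}\frac{R_n}{n/\log n}\ge r_{\inf},\quad P^x\text{-a.s.}$$
   Context: The simple random walk $(S_n)_{n\ge 0}$ on $G$ under $P^x$ is the Markov chain with $P^x(S_0=x)=1$ that at each step moves from its current vertex $z$ to each neighbour of $z$ with probability $1/\deg(z)$; $p_n(x,y)=P^x(S_n=y)$. The range is $R_n=|\{S_0,\dots,S_n\}|$. Set $T_x=\inf\{k\ge 1: S_k=x\}$ and $$r_{\inf}=\liminf_{n\to\infty}(\log n)\inf_{x\in V(G)}P^x(T_x>n).$$ $d_G$ is the graph distance on $G$ and $B(x,r)=\{y\in V(G): d_G(x,y)\le r\}$. $G$ is uniformly weakly recurrent if there exist positive constants $c,C$ such that for every $n\ge 1$ and every $x\in V(G)$, $c\le n\,(p_n(x,x)+p_{n+1}(x,x))\le C$. $G$ is Ahlfors $\alpha$-regular ($\alpha>1$) if there exist positive constants $c_1,c_2$ such that $c_1n^\alpha\le|B(x,n)|\le c_2n^\alpha$ for every $n\ge1$ and $x\in V(G)$. $G$ satisfies the sub-Gaussian heat kernel upper bounds with walk dimension $\beta>1$ if there exist positive constants $c_3,c_4$ such that for every $n\ge1$ and $x,y\in V(G)$, $$p_n(x,y)\le\frac{c_3}{|B(x,n^{1/\beta})|}\exp\left(-c_4\frac{d_G(x,y)^{\beta/(\beta-1)}}{n^{1/(\beta-1)}}\right).$$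 *)

(* Defs.v *)
From HB Require Import structures.
From mathcomp Require Export all_boot all_order all_algebra finmap.
From mathcomp Require Export all_classical all_reals all_analysis.

Set Implicit Arguments.
Unset Strict Implicit.
Unset Printing Implicit Defensive.

Export Order.TTheory GRing.Theory Num.Theory.

Local Open Scope classical_set_scope.
Local Open Scope ring_scope.

(* The cardinality [#|` fset_set A|] is 0 when [A] is infinite, so degrees and
   volumes are meaningful only on locally finite graphs; [bounded_degree]
   therefore requires finiteness of the neighbourhoods explicitly. *)
Definition nbrs (V : choiceType) (e : rel V) (x : V) : set V := [set y | e x y].

Definition deg (V : choiceType) (e : rel V) (x : V) : nat :=
  #|` fset_set (nbrs e x)|.

Definition bounded_degree (V : choiceType) (e : rel V) : Prop :=
  exists D : nat, forall x : V, finite_set (nbrs e x) /\ (deg e x <= D)%N.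

Definition walk_of_length (V : choiceType) (e : rel V) (x y : V) (k : nat) :
    Prop :=
  exists p : seq V, [/\ path e x p, last x p = y & size p = k].

Definition connected_graph (V : choiceType) (e : rel V) : Prop :=
  forall x y : V, exists k : nat, walk_of_length e x y k.

(* The junk value 0 is used only when [x] and [y] are not connected. *)
Definition gdist (V : choiceType) (e : rel V) (x y : V) : nat :=
  match pselect (exists k : nat, `[< walk_of_length e x y k >]) with
  | left h => ex_minn h
  | right _ => 0%N
  end.

Definition gball (R : realType) (V : choiceType) (e : rel V) (x : V) (r : R) :
    set V :=
  [set y | (gdist e x y)%:R <= r].

Definition gvol (R : realType) (V : choiceType) (e : rel V) (x : V) (r : R) :
    nat :=
  #|` fset_set (gball e x r)|.

(* [P x] is the law under which [S] starts at [x]. The Markov property is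
   written without conditional probabilities: the probability of a history
   [s 0, ..., s n] followed by [y] is that of the history times the transition
   probability from [s n] to [y]. *)
Record simple_random_walk (R : realType) (V : choiceType) (e : rel V)
    (d : measure_display) (T : measurableType d) (P : V -> probability T R)
    (S : nat -> T -> V) : Prop := SimpleRandomWalk {
  srw_measurable : forall (n : nat) (y : V), measurable [set w | S n w = y];
  srw_start : forall x : V, P x [set w | S 0%N w = x] = 1%:E;
  srw_step : forall (x : V) (n : nat) (s : nat -> V) (y : V),
    P x [set w | (forall i : nat, (i <= n)%N -> S i w = s i) /\
                 S n.+1 w = y] =
    (P x [set w | forall i : nat, (i <= n)%N -> S i w = s i] *
     (if e (s n) y then (deg e (s n))%:R^-1 else 0)%:E)%E
}.

Definition heat_kernel (R : realType) (V : choiceType)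
    (d : measure_display) (T : measurableType d) (P : V -> probability T R)
    (S : nat -> T -> V) (n : nat) (x y : V) : R :=
  fine (P x [set w | S n w = y]).

Definition walk_range (V : choiceType) (T : Type) (S : nat -> T -> V)
    (n : nat) (w : T) : nat :=
  #|` fset_set [set S k w | k in [set k : nat | (k <= n)%N]]|.

(* Equal to [+oo] when [S] does not visit [x] at any positive time. *)
Definition return_time (R : realType) (V : choiceType) (T : Type)
    (S : nat -> T -> V) (x : V) (w : T) : \bar R :=
  ereal_inf [set (k%:R)%:E | k in [set k : nat | (1 <= k)%N /\ S k w = x]].

Definition r_inf (R : realType) (V : choiceType)
    (d : measure_display) (T : measurableType d) (P : V -> probability T R)
    (S : nat -> T -> V) : \bar R :=
  limn_einf (fun n : nat =>
    ((ln n%:R)%:E *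
     ereal_inf [set P x [set w | (n%:R)%:E < return_time R S x w] |
                x in [set: V]])%E).

Definition uniformly_weakly_recurrent (R : realType) (V : choiceType)
    (d : measure_display) (T : measurableType d) (P : V -> probability T R)
    (S : nat -> T -> V) : Prop :=
  exists c C : R, [/\ 0 < c, 0 < C &
    forall (n : nat) (x : V), (1 <= n)%N ->
      c <= n%:R * (heat_kernel P S n x x + heat_kernel P S n.+1 x x) <= C].

Definition ahlfors_regular (R : realType) (V : choiceType) (e : rel V)
    (alpha : R) : Prop :=
  exists c1 c2 : R, [/\ 0 < c1, 0 < c2 &
    forall (n : nat) (x : V), (1 <= n)%N ->
      c1 * n%:R `^ alpha <= (gvol e x (n%:R : R))%:R <= c2 * n%:R `^ alpha].

Definition sub_gaussian_upper (R : realType) (V : choiceType) (e : rel V)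
    (d : measure_display) (T : measurableType d) (P : V -> probability T R)
    (S : nat -> T -> V) (beta : R) : Prop :=
  exists c3 c4 : R, [/\ 0 < c3, 0 < c4 &
    forall (n : nat) (x y : V), (1 <= n)%N ->
      heat_kernel P S n x y <=
        c3 / (gvol e x (n%:R `^ beta^-1 : R))%:R *
        expR (- c4 * ((gdist e x y)%:R `^ (beta / (beta - 1)) /
                      n%:R `^ (beta - 1)^-1))].

(* Main.v *)
Require Import Defs.
From mathcomp Require Import all_boot all_order all_algebra finmap.
From mathcomp Require Import all_classical all_reals all_analysis.
From mathcomp Require Import zify ring lra.

Local Open Scope classical_set_scope.
Local Open Scope ring_scope.

(** The number of distinct points of a path is its number of last visits. The
    walk at time [k] makes a visit that is not repeated in the next [m] steps
    with conditional probability at least the infimum over [x] of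
    [P^x(T_x > m)], which is at least about [r_inf / log n] as soon as [log m]
    is close to [log n]. So the mean of [R_n] is at least about
    [r_inf * n / log n], and the work is to turn this into an almost sure bound.

    The hypotheses are used through [p_n(x, y) <= C / n], which holds because
    the volume exponent is the walk dimension, and [sum_(k <= n) p_k(x, x)]
    being at least of order [log n]. By last-exit decompositions they give
    [P^x(T_x > n) <= C / log n] ([esc_dyadic]), and a probability of order
    [s / j] for hitting a given point, from any starting point, between the times
    [2 ^ (j - s)] and [2 ^ j] ([hit_dyadic]).

    Consider a block of [b = 2 ^ j] steps and windows [m = 2 ^ (j - s)] with
    [s] of order [log j]. Let [A] be the set of points visited before the block,
    and suppose that its cardinality is of order [b / j]. The number of points
    outside [A] found in the block is at least
    [kappa * b / j - 3 * eps * b / j], where [kappa = r / log 2] for a number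
    [r < r_inf], except with probability of order [s / j]
    ([block_estimate], [dyadic_block]): the number of visits not repeated within
    [2 * m] steps has a small variance because far apart contributions are
    uncorrelated ([variance_fluct]), the number of such visits that are repeated
    later has mean of order [b * (1 / j) * (s / j)], and the number of points of
    [A] that are hit has mean of order [m + (b / j) * (s / j)].

    A probability of order [s / j] is not summable over the scales [j]. Cutting
    the walk into a fixed number of blocks repairs this: if the cardinality of
    [A] exceeds the bound, the range is already large enough, and otherwise the
    block is bad with conditional probability of order [s / j], so that four bad
    blocks have a probability of order [(s / j) ^ 4 = O(1 / j ^ 2)]
    ([nbad_tail], [gap_sqr]). By Borel-Cantelli at most three blocks are bad at
    all large scales ([eventually_few_bad]), and three blocks are a small fraction
    of all the blocks. Since the range is monotone, a general [n] is compared
    with a multiple of a power of [2] ([range_ge]).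

    All estimates are proved for expectations along finite paths ([pexp]), which
    are finite sums; the law of the walk enters only through [law_event] and
    [law_cover]. *)

(** * Expectations along finite paths *)

Section PathExpectation.
Set Implicit Arguments.
Unset Strict Implicit.
Unset Printing Implicit Defensive.

Variables (R : realType) (V : choiceType) (N : V -> seq V).
Hypothesis N_neq0 : forall x, (0 < size (N x))%N.

Implicit Types (x y z : V) (s t u : seq V) (f g : seq V -> R).

(** Expectation of [f] of the positions of the walk at times [1], ..., [n], for
    the walk that starts at [x] and moves to a uniform entry of the list [N y]
    when it is at [y]. The starting point is not part of the path. *)
Fixpoint pexp (n : nat) (x : V) (f : seq V -> R) : R :=
  if n is n'.+1 then
    (size (N x))%:R^-1 * \sum_(y <- N x) pexp n' y (fun s => f (y :: s))
  else f [::].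

Lemma ler_indic (b c : bool) : (b -> c) -> b%:R <= c%:R :> R.
Proof. by case: b => [->//|_]; rewrite ler0n. Qed.

Lemma indic_le1 (b : bool) : b%:R <= 1 :> R.
Proof. exact: (@ler_indic b true). Qed.

Lemma invN_ge0 x : 0 <= (size (N x))%:R^-1 :> R.
Proof. by rewrite invr_ge0 ler0n. Qed.

Lemma pexp_eq n x f g :
  (forall s, size s = n -> f s = g s) -> pexp n x f = pexp n x g.
Proof.
elim: n x f g => [|n IH] x f g fg /=; first exact: fg.
by congr (_ * _); apply: eq_bigr => y _; apply: IH => s sn; rewrite fg //= sn.
Qed.

Lemma pexp_le n x f g :
  (forall s, size s = n -> f s <= g s) -> pexp n x f <= pexp n x g.
Proof.
elim: n x f g => [|n IH] x f g fg /=; first exact: fg.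
apply: ler_wpM2l; first exact: invN_ge0.
by apply: ler_sum => y _; apply: IH => s sn; rewrite fg //= sn.
Qed.

Lemma pexp_cst n x (c : R) : pexp n x (fun=> c) = c.
Proof.
elim: n x => [//|n IH] x /=.
rewrite (eq_bigr (fun=> c)) // big_const_seq count_predT iter_addr_0.
by rewrite -(mulr_natl c) mulrA mulVf ?mul1r // pnatr_eq0 -lt0n.
Qed.

Lemma pexpD n x f g : pexp n x (fun s => f s + g s) = pexp n x f + pexp n x g.
Proof.
elim: n x f g => [//|n IH] x f g /=.
by under eq_bigr do rewrite IH; rewrite big_split mulrDr.
Qed.

Lemma pexpZ n x (c : R) f : pexp n x (fun s => c * f s) = c * pexp n x f.
Proof.
elim: n x f => [//|n IH] x f /=.
by under eq_bigr do rewrite IH; rewrite -mulr_sumr mulrCA.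
Qed.

Lemma pexpB n x f g : pexp n x (fun s => f s - g s) = pexp n x f - pexp n x g.
Proof.
rewrite -mulN1r -pexpZ -pexpD; apply: pexp_eq => s _; by rewrite mulN1r.
Qed.

Lemma pexp_sum (I : Type) (r : seq I) (Q : pred I) n x (F : I -> seq V -> R) :
  pexp n x (fun s => \sum_(i <- r | Q i) F i s) =
  \sum_(i <- r | Q i) pexp n x (F i).
Proof.
elim: r => [|i r IH].
  rewrite big_nil -[RHS](pexp_cst n x).
  by apply: pexp_eq => s _; rewrite big_nil.
rewrite big_cons -IH; case: ifP => Qi.
  by rewrite -pexpD; apply: pexp_eq => s _; rewrite big_cons Qi.
by apply: pexp_eq => s _; rewrite big_cons Qi.
Qed.

Lemma pexp_ge0 n x f : (forall s, size s = n -> 0 <= f s) -> 0 <= pexp n x f.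
Proof. by move=> f0; rewrite -[leLHS](pexp_cst n x); apply: pexp_le. Qed.

(** The Markov property at the deterministic time [a]. *)
Lemma pexp_markov a b x f :
  pexp (a + b) x f =
  pexp a x (fun s => pexp b (last x s) (fun t => f (s ++ t))).
Proof.
elim: a x f => [//|a IH] x f /=.
by congr (_ * _); apply: eq_bigr => y _; rewrite IH.
Qed.

Lemma pexp_take a b x f : (a <= b)%N ->
  pexp b x (fun s => f (take a s)) = pexp a x f.
Proof.
move=> ab; rewrite -(subnKC ab) pexp_markov; apply: pexp_eq => s sa.
by under pexp_eq do rewrite take_size_cat//; rewrite pexp_cst.
Qed.

(** The Markov property at the time of the [k]-th entry of the tail, that is at
    time [k.+1] of the walk. *)
Lemma pexp_nth n k z (phi : V -> seq V -> R) : (k < n)%N ->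
  pexp n z (fun t => phi (nth z t k) (drop k.+1 t)) =
  pexp k.+1 z (fun s => pexp (n - k.+1) (last z s) (phi (last z s))).
Proof.
move=> kn; rewrite -{1}(subnKC kn) pexp_markov; apply: pexp_eq => s sk.
apply: pexp_eq => u _; rewrite nth_cat sk leqnn drop_size_cat //.
by rewrite -(nth_last z) sk.
Qed.

(** Markov's inequality. *)
Lemma pexp_markov_ineq n x f (c M : R) : 0 < c ->
  (forall s, size s = n -> 0 <= f s) -> pexp n x f <= M ->
  pexp n x (fun s => (c <= f s)%R%:R) <= M / c.
Proof.
move=> c0 f0 fM; rewrite ler_pdivlMr // mulrC -pexpZ; apply: le_trans fM.
apply: pexp_le => s sn; case: (boolP (c <= f s)) => cf; first by rewrite mulr1.
by rewrite mulr0 f0.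
Qed.

(** Transition probabilities of the walk. *)
Definition trans n x y : R := pexp n x (fun s => (last x s == y)%:R).

(** Probability that the walk started at [x] does not come back to [x] before
    time [n] included. *)
Definition esc n x : R := pexp n x (fun s => (x \notin s)%:R).

Lemma trans_ge0 n x y : 0 <= trans n x y.
Proof. by apply: pexp_ge0. Qed.

Lemma esc_ge0 n x : 0 <= esc n x.
Proof. by apply: pexp_ge0. Qed.

Lemma esc_le1 n x : esc n x <= 1.
Proof.
rewrite -[leRHS](pexp_cst n x); by apply: pexp_le => s _; exact: indic_le1.
Qed.

Lemma esc_antitone m n x : (m <= n)%N -> esc n x <= esc m x.
Proof.
move=> mn; rewrite /esc -[leRHS](pexp_take x _ mn); apply: pexp_le => s _.
by apply/ler_indic/contra/mem_take.
Qed.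

(** A visited point is visited for the last time exactly once. *)
Lemma last_visit_mem z x t a :
  (x \in drop a t)%:R =
  \sum_(a <= k < size t) ((nth z t k == x) && (x \notin drop k.+1 t))%:R :> R.
Proof.
elim: t a => [|y t IH] [|a].
- by rewrite big_geq.
- by rewrite big_geq.
- rewrite /= big_nat_recl //= -IH !drop0 in_cons eq_sym.
  by case: eqP; case: (x \in t); rewrite ?addr0 ?add0r.
- by rewrite /= big_add1 /= IH.
Qed.

(** Distinct entries are counted by their last occurrence. *)
Lemma last_visit_size z t :
  (size (undup t))%:R =
  \sum_(0 <= k < size t) (nth z t k \notin drop k.+1 t)%:R :> R.
Proof.
elim: t => [|y t IH]; first by rewrite big_geq.
rewrite /= big_nat_recl //= -IH drop0; case: (y \in t) => /=.
  by rewrite add0r.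
by rewrite -[LHS]natr1 addrC.
Qed.

(** Last-exit decomposition of the hitting probability of [x]. *)
Lemma hit_last_exit n a z x :
  pexp n z (fun t => (x \in drop a t)%:R) =
  \sum_(a <= k < n) trans k.+1 z x * esc (n - k.+1) x.
Proof.
transitivity (pexp n z (fun t => \sum_(a <= k < n)
    ((nth z t k == x) && (x \notin drop k.+1 t))%:R)).
  by apply: pexp_eq => t tn; rewrite (last_visit_mem z) tn.
rewrite pexp_sum [LHS]big_nat_cond [RHS]big_nat_cond; apply: eq_bigr => k.
move=> /andP[/andP[_ kn] _].
rewrite (pexp_nth z (fun v u => ((v == x) && (x \notin u))%:R) kn).
rewrite /trans [RHS]mulrC -pexpZ; apply: pexp_eq => s _.
case: eqP => [->|_] /=; first by rewrite mulr1.
by rewrite mulr0 -[RHS](pexp_cst (n - k.+1) (last z s)).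
Qed.

Lemma esc_green n x : esc n x * \sum_(0 <= k < n) trans k.+1 x x <= 1.
Proof.
apply: (@le_trans _ _ (pexp n x (fun t => (x \in drop 0 t)%:R))).
  rewrite hit_last_exit mulr_sumr; apply: ler_sum => k _.
  rewrite mulrC ler_wpM2l ?trans_ge0 //; apply: esc_antitone; exact: leq_subr.
rewrite -[leRHS](pexp_cst n x); by apply: pexp_le => s _; exact: indic_le1.
Qed.

End PathExpectation.

(** * Heat kernel bounds at dyadic scales *)

Section DyadicHarmonic.
Set Implicit Arguments.
Unset Strict Implicit.
Unset Printing Implicit Defensive.
Variable R : realType.

Lemma harmonic_octave a :
  1 / 2 <= (\sum_(2 ^ a <= k < 2 ^ a.+1) k%:R^-1 : R) <= 1.
Proof.
have p0 : 0 < (2 ^ a)%:R :> R by rewrite ltr0n expn_gt0.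
have half : 1 / 2 = \sum_(2 ^ a <= k < 2 ^ a.+1) (2 ^ a.+1)%:R^-1 :> R.
  rewrite big_const_nat iter_addr_0 expnS mul2n -addnn addnK -mulr_natl natrD.
  by field; rewrite gt_eqF ?addr_gt0.
have one : 1 = \sum_(2 ^ a <= k < 2 ^ a.+1) (2 ^ a)%:R^-1 :> R.
  rewrite big_const_nat iter_addr_0 expnS mul2n -addnn addnK.
  by rewrite -(mulr_natl (_^-1)) mulfV // gt_eqF.
have n0 : (0 < 2 ^ a)%N by rewrite expn_gt0.
apply/andP; split; [rewrite [leLHS]half | rewrite [leRHS]one].
  apply: ler_sum_nat => k /andP[ak kb].
  by rewrite lef_pV2 ?ler_nat ?posrE ?ltr0n ?expn_gt0 ?(ltnW kb) //; lia.
apply: ler_sum_nat => k /andP[ak kb].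
by rewrite lef_pV2 ?ler_nat ?posrE ?ltr0n ?expn_gt0 //; lia.
Qed.

Lemma harmonic_dyadic_ge i : i%:R / 2 <= \sum_(1 <= k < 2 ^ i) k%:R^-1 :> R.
Proof.
elim: i => [|i IH]; first by rewrite big_geq // mul0r.
rewrite (@big_cat_nat _ _ _ (2 ^ i)) ?expn_gt0 ?leq_exp2l //=.
have /andP[h _] := harmonic_octave i.
by rewrite -natr1 mulrDl lerD.
Qed.

Lemma harmonic_dyadic_le a b : (a <= b)%N ->
  \sum_(2 ^ a <= k < 2 ^ b) k%:R^-1 <= (b - a)%:R :> R.
Proof.
move=> /subnKC <-; rewrite addKn; elim: (b - a)%N => [|i IH].
  by rewrite addn0 big_geq.
rewrite (@big_cat_nat _ _ _ (2 ^ (a + i))) ?leq_exp2l ?leq_addr ?leq_add2l //=.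
have /andP[_ h] := harmonic_octave (a + i).
by rewrite -natr1 lerD // addnS.
Qed.

End DyadicHarmonic.

Section HeatKernelBounds.
Set Implicit Arguments.
Unset Strict Implicit.
Unset Printing Implicit Defensive.

Variables (R : realType) (V : choiceType) (N : V -> seq V).
Hypothesis N_neq0 : forall x, (0 < size (N x))%N.
Variables (c C : R).
Hypotheses (c_gt0 : 0 < c) (C_gt0 : 0 < C).
Hypothesis trans_le : forall n x y, (0 < n)%N -> trans R N n x y <= C / n%:R.
Hypothesis trans_ge : forall n x, (0 < n)%N ->
  c <= n%:R * (trans R N n x x + trans R N n.+1 x x).

Lemma esc_dyadic i x : (0 < i)%N -> esc R N (2 ^ i) x <= 4 / c / i%:R.
Proof.
move=> i0; have i0R : 0 < i%:R :> R by rewrite ltr0n.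
have pi : (2 ^ i = (2 ^ i).-1.+1)%N by rewrite prednK ?expn_gt0.
set G := \sum_(0 <= k < 2 ^ i) trans R N k.+1 x x.
have t0 k : 0 <= trans R N k x x by exact: trans_ge0.
have lowG : c * (i%:R / 2) <= 2 * G.
  apply: (@le_trans _ _
    (\sum_(1 <= k < 2 ^ i) (trans R N k x x + trans R N k.+1 x x))).
    apply: le_trans (ler_wpM2l (ltW c_gt0) (harmonic_dyadic_ge R i)) _.
    rewrite mulr_sumr; apply: ler_sum_nat => k /andP[k0 _].
    by rewrite ler_pdivrMr ?ltr0n // mulrC trans_ge.
  rewrite big_split /= mulr_natl mulr2n; apply: lerD.
    rewrite big_add1 /= /G {2}pi big_nat_recr //= lerDl; exact: t0.
  rewrite /G [leRHS]big_ltn ?expn_gt0 // lerDr; exact: t0.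
have eG := esc_green R N_neq0 (2 ^ i) x; rewrite -/G in eG.
have e0 := esc_ge0 R N_neq0 (2 ^ i) x.
rewrite -mulrA -invfM ler_pdivlMr ?mulr_gt0 //; nra.
Qed.

(** Last-exit decomposition over the time [k] of the last visit to [x]: the walk
    is at [x] at time [k] with probability at most [C / k], and then avoids [x]
    for a time [2 ^ (j - s)] with probability of order [1 / (j - s)]. The last
    [2 ^ (j - s)] times, for which only the first bound is used, contribute the
    second term. *)
Lemma hit_dyadic j s z x : (0 < s)%N -> (s < j)%N ->
  pexp (R:=R) N (2 ^ j) z (fun t => (x \in drop (2 ^ (j - s)) t)%:R) <=
  C * s%:R * (4 / c / (j - s)%:R) + 2 * C / (2 ^ s)%:R.
Proof.
move=> s0 sj; rewrite hit_last_exit //.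
set m := (2 ^ (j - s))%N; set b := (2 ^ j)%N.
have bms : (b = m * 2 ^ s)%N by rewrite -expnD subnK // ltnW.
have m0 : (0 < m)%N by rewrite expn_gt0.
have s2 : (2 <= 2 ^ s)%N by rewrite -{1}(expn1 2) leq_exp2l.
have mb : (2 * m <= b)%N by rewrite bms mulnC leq_mul2l s2 orbT.
set E := 4 / c / _.
have E0 : 0 <= E by rewrite !divr_ge0 // ltW.
rewrite (@big_cat_nat _ _ _ (b - m)) /=; [|lia|lia].
apply: lerD.
  apply: (@le_trans _ _ (\sum_(m <= k < b) C / k%:R * E)).
    rewrite [leRHS](@big_cat_nat _ _ _ (b - m)) /=; [|lia|lia].
    rewrite -[leLHS]addr0; apply: lerD; last first.
      by apply: sumr_ge0 => k _; rewrite mulr_ge0 // divr_ge0 // ltW.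
    apply: ler_sum_nat => k /andP[mk kb].
    apply: ler_pM; rewrite ?trans_ge0 ?esc_ge0 //.
      apply: le_trans (trans_le _ _ _) _ => //.
      by rewrite ler_pM2l // lef_pV2 ?posrE ?ltr0n ?ler_nat //; lia.
    apply: le_trans (esc_dyadic x _); last by rewrite subn_gt0.
    by apply: esc_antitone => //; rewrite -/m; lia.
  rewrite -mulr_suml -mulr_sumr ler_wpM2r // ler_wpM2l ?(ltW C_gt0) //.
  apply: le_trans (harmonic_dyadic_le R (leq_subr s j)) _.
  by rewrite subKn // ltnW.
apply: (@le_trans _ _ (\sum_(b - m <= k < b) 2 * C / b%:R)).
  apply: ler_sum_nat => k /andP[mk kb].
  rewrite -[leRHS]mulr1; apply: ler_pM; rewrite ?trans_ge0 ?esc_ge0 ?esc_le1 //.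
  apply: le_trans (trans_le _ _ _) _ => //.
  rewrite ler_pdivrMr ?ltr0n // mulrAC ler_pdivlMr ?ltr0n ?expn_gt0 //.
  have : b%:R <= 2 * k.+1%:R :> R by rewrite -natrM ler_nat; lia.
  by move=> h; rewrite -mulrA (mulrCA 2) ler_pM2l.
rewrite big_const_nat iter_addr_0 subKn; last by lia.
rewrite bms natrM -mulr_natl.
have m0R : 0 < m%:R :> R by rewrite ltr0n.
have s0R : 0 < (2 ^ s)%:R :> R by rewrite ltr0n expn_gt0.
rewrite le_eqVlt; apply/orP; left; apply/eqP; field.
by rewrite !gt_eqF.
Qed.

End HeatKernelBounds.

(** * One block: the number of new points *)

Section BlockEstimate.
Set Implicit Arguments.
Unset Strict Implicit.
Unset Printing Implicit Defensive.

Variables (R : realType) (V : choiceType) (N : V -> seq V).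
Hypothesis N_neq0 : forall x, (0 < size (N x))%N.

Local Notation E := (pexp (R:=R) N).
Implicit Types (x y z : V) (s t u : seq V).

(** The number of distinct points of [t] outside [A]. *)
Definition fresh (A t : seq V) : nat := size [seq v <- undup t | v \notin A].

Lemma size_undup_cat s t :
  size (undup (s ++ t)) = (size (undup s) + fresh s t)%N.
Proof.
have /perm_size -> : perm_eq (undup (s ++ t)) (undup (t ++ s)).
  apply: uniq_perm; rewrite ?undup_uniq // => v.
  by rewrite !mem_undup !mem_cat orbC.
by rewrite undup_cat size_cat addnC.
Qed.

Variables (b m : nat) (e1 h q : R).
Hypothesis esc_le : forall x, esc R N m x <= e1.
Hypothesis hit_le : forall z x, E b z (fun t => (x \in drop m t)%:R) <= h.
Hypothesis esc_ge : forall x, q <= esc R N (2 * m) x.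

Lemma e1_ge0 (x : V) : 0 <= e1.
Proof. by apply: le_trans (esc_le x); apply: esc_ge0. Qed.

Lemma h_ge0 (x : V) : 0 <= h.
Proof. by apply: le_trans (hit_le x x); apply: pexp_ge0. Qed.

Lemma size_undup_fresh A t : uniq A ->
  (size (undup t) <= fresh A t + (m + count (mem (drop m t)) A))%N.
Proof.
move=> uA; rewrite -(count_predC (fun v => v \notin A) (undup t)).
rewrite -size_filter leq_add2l -!size_filter.
set B := [seq v <- A | v \in drop m t].
apply: (@leq_trans (size (take m t ++ B))).
  apply: uniq_leq_size; first by rewrite filter_uniq // undup_uniq.
  move=> v; rewrite mem_filter /= negbK mem_undup => /andP[vA vt].
  rewrite mem_cat mem_filter vA andbT; move: vt.
  by rewrite -{1}(cat_take_drop m t) mem_cat.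
by rewrite size_cat leq_add2r size_take_min geq_minl.
Qed.

Lemma exp_hits A z :
  E b z (fun t => (count (mem (drop m t)) A)%:R) <= (size A)%:R * h.
Proof.
have -> : (size A)%:R * h = \sum_(v <- A) h.
  by rewrite big_const_seq count_predT iter_addr_0 mulr_natl.
under pexp_eq do rewrite -sum1_count natr_sum big_mkcond /=.
rewrite pexp_sum // big_seq [leRHS]big_seq; apply: ler_sum => v _.
apply: le_trans (hit_le z v); apply: pexp_le => t _.
by case: (v \in _).
Qed.

(** Number of times of [t] after which the walk avoids its position for [2 * m]
    steps, or up to the end of [t] when fewer steps remain. *)
Definition locally_last z t : R :=
  \sum_(0 <= k < b) (nth z t k \notin take (2 * m) (drop k.+1 t))%:R.

(** Number of times of [t] whose position is avoided for [m] steps and visited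
    after more than [2 * m] steps. The gap between [m] and [2 * m] lets the walk
    forget its position before it comes back. *)
Definition late_return z t : R :=
  \sum_(0 <= k < b) ((nth z t k \notin take m (drop k.+1 t)) &&
                     (nth z t k \in drop (2 * m) (drop k.+1 t)))%:R.

Lemma size_undup_ge z t : size t = b ->
  locally_last z t - late_return z t <= (size (undup t))%:R.
Proof.
move=> tb; rewrite (last_visit_size _ z) tb -sumrB; apply: ler_sum => k _.
set x := nth z t k; set u := drop _ t.
rewrite lerBlDr -{2}(cat_take_drop (2 * m) u) mem_cat negb_or.
have xm : x \notin take (2 * m) u -> x \notin take m u.
  apply: contra => xu.
  have -> : take (2 * m) u = take m u ++ take m (drop m u).
    by rewrite mul2n -addnn takeD.
  by rewrite mem_cat xu.
case: (boolP (x \in take (2 * m) u)) xm => [_ _|_ /(_ isT) ->] /=.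
  by rewrite addr_ge0.
by case: (x \in drop _ u); rewrite /= ?addr0 ?add0r.
Qed.

Lemma hit_le_short n z x : (n <= b)%N ->
  E n z (fun t => (x \in drop m t)%:R) <= h.
Proof.
move=> nb; apply: le_trans (hit_le z x).
rewrite -(pexp_take N_neq0 z _ nb); apply: pexp_le => t _; apply: ler_indic.
case: (leqP m n) => mn; last by rewrite drop_oversize // size_take_min; lia.
by rewrite -(subnK mn) -take_drop; exact: mem_take.
Qed.

Lemma exp_late_return z : E b z (late_return z) <= b%:R * (e1 * h).
Proof.
have -> : b%:R * (e1 * h) = \sum_(0 <= k < b) (e1 * h).
  by rewrite big_const_nat iter_addr_0 subn0 mulr_natl.
rewrite pexp_sum //; apply: ler_sum_nat => k /andP[_ kb].
rewrite (pexp_nth _ _ (fun v u => ((v \notin take m u) &&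
  (v \in drop (2 * m) u))%:R) kb).
rewrite -[leRHS](pexp_cst N_neq0 k.+1 z); apply: pexp_le => s _.
move: (last z s) => x; set n := (b - k.+1)%N.
have nb : (n <= b)%N by exact: leq_subr.
have [mn|mn] := leqP n (2 * m).
  rewrite (@pexp_eq _ _ _ _ _ _ (fun=> 0)); last first.
    by move=> u un; rewrite (drop_oversize (n := 2 * m)) ?un // in_nil andbF.
  by rewrite pexp_cst // mulr_ge0 ?(e1_ge0 x) ?(h_ge0 x).
have -> : n = (m + (n - m))%N by lia.
rewrite pexp_markov.
apply: (@le_trans _ _ (E m x (fun s => h * (x \notin s)%:R))); last first.
  by rewrite pexpZ mulrC ler_wpM2r ?(h_ge0 x) //; exact: esc_le.
apply: pexp_le => v vm.
apply: (@le_trans _ _ (E (n - m) (last x v) (fun u => (x \notin v)%:R *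
   (x \in drop m u)%:R))).
  apply: pexp_le => u _; rewrite take_size_cat // drop_cat vm.
  rewrite ltnNge leq_pmull //= mul2n -addnn addnK.
  by case: (x \notin v); case: (x \in _); rewrite ?mulr1 ?mulr0 ?mul0r.
rewrite pexpZ mulrC ler_wpM2r //; apply: hit_le_short; lia.
Qed.

(** Indicator that [u] avoids [x] for [2 * m] steps, minus its mean. *)
Definition centred n x u : R :=
  (x \notin take (2 * m) u)%:R -
  E n x (fun v => (x \notin take (2 * m) v)%:R).

Lemma exp_centred n x : E n x (centred n x) = 0.
Proof. by rewrite /centred pexpB // pexp_cst // subrr. Qed.

Lemma centred_norm n x u : `|centred n x u| <= 1.
Proof.
have : 0 <= E n x (fun v => (x \notin take (2 * m) v)%:R) <= 1.
  rewrite pexp_ge0 //= -[leRHS](pexp_cst N_neq0 n x); apply: pexp_le => v _.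
  exact: indic_le1.
have := @indic_le1 R (x \notin take (2 * m) u).
have : 0 <= (x \notin take (2 * m) u)%:R :> R by [].
rewrite /centred ler_norml; lra.
Qed.

(** Contribution of the [k]-th entry of [t] to the fluctuation of
    [locally_last]; its conditional mean given the path up to that entry is [0]. *)
Definition fluct z k t : R :=
  centred (b - k.+1) (nth z t k) (drop k.+1 t).

(** The first factor is determined by the path up to time [l.+1], given which
    the second one has mean [0]. *)
Lemma fluct_orthogonal z k l : (k + 2 * m < l)%N -> (l < b)%N ->
  E b z (fun t => fluct z k t * fluct z l t) = 0.
Proof.
move=> kl lb; rewrite -(subnKC lb) pexp_markov.
rewrite -[RHS](pexp_cst N_neq0 l.+1 z); apply: pexp_eq => s sl.
have kl' : (k < l)%N by lia.
pose c := (nth z s k \notin take (2 * m) (drop k.+1 s))%:R -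
  E (b - k.+1) (nth z s k) (fun v => (nth z s k \notin take (2 * m) v)%:R).
rewrite (@pexp_eq _ _ _ _ _ _ (fun t => c * centred (b - l.+1) (last z s) t)).
  by rewrite pexpZ exp_centred mulr0.
move=> t _; congr (_ * _); rewrite /fluct nth_cat sl.
  rewrite ltnS (ltnW kl') /c /centred drop_cat sl ltnS kl' takel_cat //.
  by rewrite size_drop sl; lia.
by rewrite ltnS leqnn drop_size_cat // -(nth_last z) sl.
Qed.

Lemma exp_fluct_le1 z k l : E b z (fun t => fluct z k t * fluct z l t) <= 1.
Proof.
rewrite -[leRHS](pexp_cst N_neq0 b z); apply: pexp_le => t _.
apply: le_trans (ler_norm _) _; rewrite normrM -[leRHS]mulr1.
by rewrite ler_pM // centred_norm.
Qed.

Lemma variance_fluct z :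
  E b z (fun t => (\sum_(0 <= k < b) fluct z k t) ^+ 2) <=
  b%:R * (4 * m + 1)%:R.
Proof.
have -> : b%:R * (4 * m + 1)%:R = \sum_(0 <= k < b) (4 * m + 1)%:R :> R.
  by rewrite big_const_nat iter_addr_0 subn0 mulr_natl.
under pexp_eq do rewrite expr2 big_distrlr /=.
rewrite pexp_sum //; apply: ler_sum_nat => k /andP[_ kb].
rewrite pexp_sum //.
apply: (@le_trans _ _ (\sum_(0 <= l < b)
    ((k <= l + 2 * m) && (l <= k + 2 * m))%N%:R)).
  apply: ler_sum_nat => l /andP[_ lb].
  case: (leqP k) => /= h1; last first.
    under pexp_eq do rewrite mulrC.
    by rewrite fluct_orthogonal.
  case: (leqP l) => /= h2; last by rewrite fluct_orthogonal.
  exact: exp_fluct_le1.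
rewrite -natr_sum ler_nat -big_mkcond sum1_count -size_filter.
rewrite -(size_iota (k - 2 * m) (4 * m + 1)); apply: uniq_leq_size.
  by rewrite filter_uniq // iota_uniq.
by move=> l; rewrite mem_filter !mem_iota; lia.
Qed.

Lemma locally_last_ge z t :
  b%:R * q + \sum_(0 <= k < b) fluct z k t <= locally_last z t.
Proof.
have -> : b%:R * q = \sum_(0 <= k < b) q.
  by rewrite big_const_nat iter_addr_0 subn0 mulr_natl.
rewrite -big_split /=; apply: ler_sum => k _.
rewrite /fluct /centred addrCA gerDl subr_le0.
move: (nth z t k) (b - k.+1)%N => x n; apply: le_trans (esc_ge x) _.
have [mn|mn] := leqP (2 * m) n.
  by rewrite /esc -(pexp_take N_neq0 x _ mn).
apply: le_trans (esc_antitone R N_neq0 x (ltnW mn)) _.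
by apply: pexp_le => u un; rewrite take_oversize // un ltnW.
Qed.

(** The three terms bound the probabilities that [locally_last] is too small,
    that [late_return] is too large, and that too many points of [A] are hit. *)
Lemma block_estimate A z (delta : R) : (0 < b)%N -> 0 < delta -> uniq A ->
  E b z (fun t => ((fresh A t)%:R < (q - 3 * delta) * b%:R)%R%:R) <=
  (4 * m + 1)%:R / (delta ^+ 2 * b%:R) + e1 * h / delta +
  (m%:R + (size A)%:R * h) / (delta * b%:R).
Proof.
move=> b0 d0 uA; have b0R : 0 < b%:R :> R by rewrite ltr0n.
have db0 : 0 < delta * b%:R by rewrite mulr_gt0.
pose F t := \sum_(0 <= k < b) fluct z k t.
pose H t : R := m%:R + (count (mem (drop m t)) A)%:R.
apply: (@le_trans _ _ (E b z (fun t =>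
  ((delta * b%:R) ^+ 2 <= F t ^+ 2)%R%:R +
  (delta * b%:R <= late_return z t)%R%:R + (delta * b%:R <= H t)%R%:R))).
  apply: pexp_le => t tb.
  case: (lerP ((delta * b%:R) ^+ 2)) => h1.
    apply: le_trans (indic_le1 _ _) _; rewrite -addrA lerDl addr_ge0 //.
  case: (lerP (delta * b%:R) (late_return z t)) => h2.
    by apply: le_trans (indic_le1 _ _) _; rewrite add0r lerDl.
  case: (lerP (delta * b%:R) (H t)) => h3.
    by apply: le_trans (indic_le1 _ _) _; rewrite add0r add0r.
  rewrite !addr0; case: ltrP => // h4; exfalso.
  have h5 := @locally_last_ge z t; rewrite -/(F t) in h5.
  have h6 := size_undup_ge z tb.
  have h7 : (size (undup t))%:R <= (fresh A t)%:R + H t.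
    by rewrite /H -!natrD ler_nat size_undup_fresh.
  have h8 : - (delta * b%:R) < F t by nra.
  nra.
rewrite !pexpD; apply: lerD; first apply: lerD.
- have -> : (4 * m + 1)%:R / (delta ^+ 2 * b%:R) =
      (b%:R * (4 * m + 1)%:R) / (delta * b%:R) ^+ 2.
    by field; rewrite !gt_eqF.
  apply: pexp_markov_ineq => //; first by rewrite exprn_gt0.
    by move=> s _; rewrite sqr_ge0.
  exact: variance_fluct.
- have -> : e1 * h / delta = (b%:R * (e1 * h)) / (delta * b%:R).
    by field; rewrite !gt_eqF.
  apply: pexp_markov_ineq (exp_late_return z) => // t _.
  by apply: sumr_ge0.
- apply: pexp_markov_ineq => //; first by move=> t _; rewrite addr_ge0.
  by rewrite pexpD pexp_cst // lerD2l exp_hits.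
Qed.

End BlockEstimate.

(** * Many blocks: the number of bad ones *)

Section ManyBlocks.
Set Implicit Arguments.
Unset Strict Implicit.
Unset Printing Implicit Defensive.

Variables (R : realType) (V : choiceType) (N : V -> seq V).
Hypothesis N_neq0 : forall x, (0 < size (N x))%N.
Variables (b : nat) (rho theta : R).
Local Notation E := (pexp (R:=R) N).
Implicit Types (s t : seq V).

(** A block [t] following the history [s] is bad when it discovers fewer than
    [theta] new points although [s] has at most [rho] distinct points. *)
Definition bad s t : bool :=
  ((size (undup s))%:R <= rho) && ((fresh s t)%:R < theta).

(** Number of bad blocks among the first [l] blocks of length [b] of [s]. *)
Definition nbad (l : nat) s : nat :=
  \sum_(0 <= i < l) bad (take (i * b) s) (take b (drop (i * b) s)).

Lemma nbadS l s t : size s = (l * b)%N -> size t = b ->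
  nbad l.+1 (s ++ t) = (nbad l s + bad s t)%N.
Proof.
move=> sl tb; rewrite /nbad big_nat_recr //=; congr (_ + _)%N.
  apply: eq_big_nat => i /andP[_ il].
  have ib : (i * b + b <= size s)%N.
    by rewrite sl addnC -mulSn leq_mul2r il orbT.
  rewrite takel_cat; last by lia.
  rewrite drop_cat; case: ltnP => h.
    by rewrite takel_cat // size_drop; lia.
  have b0 : b = 0%N by lia.
  by rewrite b0 !take0.
by rewrite take_size_cat // drop_size_cat // take_oversize // tb.
Qed.

(** Whatever the past, the next block is bad with probability at most [p]; the
    factor [l ^+ k] accounts for the positions of [k] bad blocks. *)
Lemma nbad_tail (p : R) : 0 <= p ->
  (forall A z, uniq A -> (size A)%:R <= rho ->
     E b z (fun t => ((fresh A t)%:R < theta)%R%:R) <= p) ->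
  forall l k x,
  E (l * b) x (fun s => (k <= nbad l s)%N%:R) <= (l%:R * p) ^+ k.
Proof.
move=> p0 Hp; elim=> [|l IH] [|k] x.
- by rewrite expr0; exact: indic_le1.
- by rewrite /= /nbad big_geq //= mul0r expr0n.
- rewrite expr0 -[leRHS](pexp_cst N_neq0 (l.+1 * b) x).
  by apply: pexp_le => s _; exact: indic_le1.
have lp0 : 0 <= l%:R * p by rewrite mulr_ge0.
rewrite mulSn addnC pexp_markov.
apply: (@le_trans _ _ (E (l * b) x
   (fun s => (k.+1 <= nbad l s)%N%:R + p * (k <= nbad l s)%N%:R))); last first.
  rewrite pexpD pexpZ.
  apply: (@le_trans _ _ ((l%:R * p) ^+ k.+1 + p * (l%:R * p) ^+ k)).
    by rewrite lerD ?IH // ler_wpM2l ?IH.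
  have -> : l.+1%:R * p = l%:R * p + p by rewrite -natr1 mulrDl mul1r.
  rewrite exprS -mulrDl exprS.
  apply: ler_wpM2l; first by rewrite addr_ge0.
  by rewrite lerXn2r ?nnegrE ?addr_ge0 // lerDl.
apply: pexp_le => s sl.
apply: (@le_trans _ _ (E b (last x s) (fun t => (k.+1 <= nbad l s)%N%:R +
    (k <= nbad l s)%N%:R * (bad s t)%:R))).
  apply: pexp_le => t tb; rewrite nbadS //.
  case: (bad s t); rewrite ?mulr0 ?mulr1 ?addn0 ?addr0 // addn1 ltnS.
  by rewrite lerDr.
rewrite pexpD pexp_cst // pexpZ lerD2l mulrC ler_wpM2r //.
case: (boolP ((size (undup s))%:R <= rho)) => hs; last first.
  rewrite (@pexp_eq _ _ _ _ _ _ (fun=> 0)) ?pexp_cst //.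
  by move=> t _; rewrite /bad (negbTE hs).
apply: le_trans (Hp _ (last x s) (undup_uniq s) hs).
apply: pexp_le => t _; apply: ler_indic => /andP[_].
rewrite /fresh (_ : [seq v <- _ | v \notin undup s] = 
  [seq v <- undup t | v \notin s]) //.
by apply: eq_filter => v; rewrite mem_undup.
Qed.

Lemma size_undup_take_leq s i j : (i <= j)%N ->
  (size (undup (take i s)) <= size (undup (take j s)))%N.
Proof.
move=> ij; apply: uniq_leq_size; first exact: undup_uniq.
move=> v; rewrite !mem_undup; have -> : take i s = take i (take j s).
  by rewrite take_takel.
exact: mem_take.
Qed.

(** Each block that is not bad adds [theta] points, unless the range has already
    exceeded [rho]. *)
Lemma nbad_range_aux l s : 0 <= theta -> (l * b <= size s)%N ->
  (l%:R - (nbad l s)%:R) * theta <= (size (undup (take (l * b) s)))%:R \/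
  rho < (size (undup (take (l * b) s)))%:R.
Proof.
move=> t0; elim: l => [|l IH] ls.
  by left; rewrite /nbad big_geq // subrr mul0r.
have mono : (size (undup (take (l * b) s)))%:R <=
    (size (undup (take (l.+1 * b) s)))%:R :> R.
  by rewrite ler_nat size_undup_take_leq // leq_mul2r leqnSn orbT.
have ls' : (l * b <= size s)%N by rewrite mulSn in ls; lia.
case: (IH ls') => h; last by right; exact: lt_le_trans mono.
have e : (nbad l.+1 s = nbad l s +
    bad (take (l * b) s) (take b (drop (l * b) s)))%N.
  by rewrite /nbad big_nat_recr.
have esz : size (undup (take (l.+1 * b) s)) = (size (undup (take (l * b) s)) +
    fresh (take (l * b) s) (take b (drop (l * b) s)))%N.
  by rewrite -size_undup_cat mulSnr takeD.
rewrite e -natr1 natrD.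
case: (boolP (bad _ _)) => hb /=.
  by left; apply: le_trans mono; apply: le_trans h; rewrite ler_wpM2r //; lra.
move: hb; rewrite /bad negb_and -ltNge -leNgt => /orP[hb|hb].
  by right; exact: lt_le_trans mono.
left; rewrite addr0 esz natrD.
by rewrite addrAC mulrDl mul1r; exact: lerD.
Qed.

Lemma nbad_range l L k s : 0 <= theta -> l%:R * theta <= rho ->
  (L <= l)%N -> (L * b <= size s)%N -> (nbad l s <= k)%N ->
  (L%:R - k%:R) * theta <= (size (undup (take (L * b) s)))%:R.
Proof.
move=> t0 hr Ll Ls nk.
have nL : (nbad L s)%:R <= k%:R :> R.
  rewrite ler_nat; apply: leq_trans nk.
  by rewrite /nbad [leqRHS](@big_cat_nat _ _ _ L) //= leq_addr.
have Ll' : L%:R <= l%:R :> R by rewrite ler_nat.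
case: (nbad_range_aux t0 Ls) => [|/ltW] h; apply: le_trans h.
  by rewrite ler_wpM2r // lerB.
apply: le_trans hr; rewrite ler_wpM2r //.
by rewrite (le_trans _ Ll') // gerBl.
Qed.

End ManyBlocks.

Section DyadicBlocks.
Set Implicit Arguments.
Unset Strict Implicit.
Unset Printing Implicit Defensive.

(** Blocks of length [2 ^ j] have windows of length [2 ^ (j - gap j)]. The gap is
    large enough for [2 ^ gap j >= j ^ 3] and small enough for [gap j] to be at
    most of order the square root of [j]. *)
Definition gap (j : nat) : nat := (3 * (trunc_log 2 j).+1)%N.

Lemma gap_exp j : (j ^ 3 <= 2 ^ gap j)%N.
Proof.
case: j => [//|j]; rewrite /gap mulnC expnM leq_exp2r //.
by rewrite ltnW // trunc_log_ltn.
Qed.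

Lemma gap_sqr j : (0 < j)%N -> (gap j ^ 2 <= 36 * j)%N.
Proof.
move=> j0; have : (2 ^ trunc_log 2 j <= j)%N by apply: trunc_logP.
have : ((trunc_log 2 j).+1 ^ 2 <= 4 * 2 ^ trunc_log 2 j)%N.
  elim: (trunc_log 2 j) => [//|[//|[//|k]] IH].
  move: IH; rewrite (expnS 2 k.+2); move: (2 ^ k.+2)%N => u; nia.
rewrite /gap expnMn; lia.
Qed.

Lemma gap_half j : (144 <= j)%N -> (2 * gap j <= j)%N.
Proof. by move=> hj; have := @gap_sqr j ltac:(lia); nia. Qed.

Variables (R : realType) (V : choiceType) (N : V -> seq V).
Hypothesis N_neq0 : forall x, (0 < size (N x))%N.
Variables (c C r : R).
Hypotheses (c_gt0 : 0 < c) (C_gt0 : 0 < C).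
Hypothesis trans_le : forall n x y, (0 < n)%N -> trans R N n x y <= C / n%:R.
Hypothesis trans_ge : forall n x, (0 < n)%N ->
  c <= n%:R * (trans R N n x x + trans R N n.+1 x x).
Hypothesis esc_log : \forall n \near \oo, forall x, r <= ln n%:R * esc R N n x.

Lemma ln2_gt0 : 0 < ln 2 :> R.
Proof. by rewrite ln_gt0 // ltr1n. Qed.

Lemma ln_pow2 j : ln (2 ^ j)%:R = j%:R * ln 2 :> R.
Proof. by rewrite natrX lnXn // mulr_natl. Qed.

(** [block_estimate] at scale [2 ^ j], with [delta = eps / j] and the escape and
    hitting probabilities bounded by [esc_dyadic] and [hit_dyadic]. *)
Lemma dyadic_block (eps rho : R) : 0 < eps -> 0 <= rho ->
  exists2 D : R, 0 <= D & \forall j \near \oo, forall A z, uniq A ->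
    (size A)%:R <= rho * ((2 ^ j)%:R / j%:R) ->
    pexp N (2 ^ j) z (fun t => ((fresh A t)%:R <
      (r / ln 2 - 3 * eps) * ((2 ^ j)%:R / j%:R))%R%:R) <=
    D * ((gap j)%:R / j%:R).
Proof.
move=> eps0 rho0; case: esc_log => n0 _ Hn0.
pose K := 8 * C / c + 2 * C.
have K0 : 0 < K by rewrite addr_gt0 ?divr_gt0 ?mulr_gt0.
exists (5 / eps ^+ 2 + 8 * K / (c * eps) + (1 + rho * K) / eps).
  by do ?[apply: addr_ge0 | apply: divr_ge0 | apply: mulr_ge0];
    rewrite ?exprn_ge0 ?(ltW eps0) ?(ltW c_gt0) ?(ltW C_gt0).
exists (144 + 2 * n0)%N => // j /= hj A z uA hA.
have [[j0 s0 sj] [js js2 jn jS]] : [/\ (0 < j)%N, (0 < gap j)%N & (gap j < j)%N]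
    /\ [/\ (0 < j - gap j)%N, (j <= 2 * (j - gap j))%N,
    (n0 <= (j - gap j).+1)%N & ((j - gap j).+1 <= j)%N].
  have : (0 < gap j)%N by []; have : (2 * gap j <= j)%N.
    by apply: gap_half; exact: leq_trans (leq_addr _ _) hj.
  by move: (gap j) hj => s; clear; repeat split; lia.
clear hj; set s := gap j in s0 sj js js2 jn jS *.
set m := (2 ^ (j - s))%N; set b := (2 ^ j)%N in hA *.
have ln20 := ln2_gt0.
have j0R : 0 < j%:R :> R by rewrite ltr0n.
have s1R : 1 <= s%:R :> R by rewrite ler1n.
have j1R : 1 <= j%:R :> R by rewrite ler1n.
have b0R : 0 < b%:R :> R by rewrite ltr0n expn_gt0.
have m0R : 0 < m%:R :> R by rewrite ltr0n expn_gt0.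
have pows : j%:R ^+ 3 <= (2 ^ s)%:R :> R by rewrite -natrX ler_nat gap_exp.
have p0R : 0 < (2 ^ s)%:R :> R by rewrite ltr0n expn_gt0.
have bmR : b%:R = m%:R * (2 ^ s)%:R :> R.
  by rewrite -natrM -expnD subnK // ltnW.
have jsR : j%:R <= 2 * (j - s)%:R :> R by rewrite -natrM ler_nat.
have js0 : 0 < (j - s)%:R :> R by rewrite ltr0n.
pose e1 := 8 / c / j%:R; pose h := K * (s%:R / j%:R).
have dj : 4 / c / (j - s)%:R <= e1.
  rewrite /e1 ler_pdivrMr // mulrAC ler_pdivlMr // -!mulrA.
  rewrite [leLHS]mulrCA [leRHS]mulrCA ler_pM2l ?invr_gt0 //; lra.
have Hesc x : esc R N m x <= e1.
  by apply: le_trans dj; apply: (esc_dyadic N_neq0 c_gt0 trans_ge).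
have Hhit y x : pexp (R:=R) N b y (fun t => (x \in drop m t)%:R) <= h.
  apply: le_trans
    (hit_dyadic N_neq0 c_gt0 C_gt0 trans_le trans_ge _ _ s0 sj) _ => //.
  have -> : h = C * s%:R * e1 + 2 * C * (s%:R / j%:R).
    by rewrite /h /K /e1; field; rewrite !gt_eqF.
  apply: lerD; first by rewrite ler_wpM2l // mulr_ge0 // ltW.
  rewrite -mulrA -[leRHS]mulrA !ler_pM2l //.
  rewrite ler_pdivlMr // mulrC ler_pdivrMr //.
  nra.
have Hq x : r / ln 2 / j%:R <= esc R N (2 * m) x.
  have -> : (2 * m = 2 ^ (j - s).+1)%N by rewrite expnS.
  have /(_ x) : forall x, r <= ln (2 ^ (j - s).+1)%:R *
      esc R N (2 ^ (j - s).+1) x.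
    by apply: Hn0 => /=; apply: leq_trans (ltnW (ltn_expl _ _)).
  rewrite ln_pow2 ler_pdivrMr // ler_pdivrMr // => hr.
  apply: le_trans hr _; rewrite mulrC -mulrA ler_wpM2l ?esc_ge0 //.
  by rewrite ler_pM2r // ler_nat.
have dp : 0 < eps / j%:R by rewrite divr_gt0.
have := block_estimate N_neq0 Hesc Hhit Hq z _ dp uA.
rewrite -/b expn_gt0 => /(_ isT).
have -> : (r / ln 2 / j%:R - 3 * (eps / j%:R)) * b%:R =
   (r / ln 2 - 3 * eps) * (b%:R / j%:R) by field; rewrite !gt_eqF.
move=> H; apply: le_trans H _.
rewrite [leRHS]mulrDl [X in _ <= X + _]mulrDl; apply: lerD; first apply: lerD.
- have m5 : (4 * m + 1)%:R <= 5 * m%:R :> R.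
    by rewrite -natrM ler_nat [leqRHS]mulSnr leq_add2l expn_gt0.
  rewrite ler_pdivrMr ?mulr_gt0 ?exprn_gt0 ?invr_gt0 //; apply: le_trans m5 _.
  rewrite bmR.
  have -> : 5 / eps ^+ 2 * (s%:R / j%:R) * ((eps / j%:R) ^+ 2 *
     (m%:R * (2 ^ s)%:R)) = 5 * m%:R * (s%:R * ((2 ^ s)%:R / j%:R ^+ 3)).
    by field; rewrite !gt_eqF.
  rewrite ler_peMr ?mulr_ge0 ?(ltW m0R) //.
  by rewrite -[leLHS]mulr1 ler_pM // ler_pdivlMr ?exprn_gt0 // mul1r.
- rewrite le_eqVlt; apply/orP; left; apply/eqP; rewrite /e1 /h.
  by field; rewrite !gt_eqF.
- rewrite ler_pdivrMr ?mulr_gt0 ?invr_gt0 //.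
  have -> : (1 + rho * K) / eps * (s%:R / j%:R) * (eps / j%:R * b%:R) =
     b%:R * (s%:R / j%:R ^+ 2) + rho * (b%:R / j%:R) * h.
    by rewrite /h; field; rewrite !gt_eqF.
  apply: lerD.
    rewrite bmR -mulrA ler_peMr ?(ltW m0R) //.
    rewrite mulrA ler_pdivlMr ?exprn_gt0 // mul1r.
    apply: (@le_trans _ _ (j%:R ^+ 3)); last by nra.
    by rewrite [leRHS]exprS ler_peMl // exprn_ge0 // ltW.
  by rewrite ler_wpM2r // mulr_ge0 ?divr_ge0 ?ltW.
Qed.

End DyadicBlocks.

(** * The law of the walk *)

Section LawOfWalk.
Set Implicit Arguments.
Unset Strict Implicit.
Unset Printing Implicit Defensive.

Variables (R : realType) (V : choiceType) (e : rel V).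
Variables (disp : measure_display) (T : measurableType disp).
Variables (P : V -> probability T R) (S : nat -> T -> V).
Hypothesis nbrs_finite : forall x, finite_set (nbrs e x).
Hypothesis deg_gt0 : forall x, (0 < deg e x)%N.
Hypothesis walkS : simple_random_walk e P S.

(** The neighbours of [x] in a list without repetition, so that [pexp nb] is the
    expectation for the simple random walk. *)
Definition nb (x : V) : seq V := fset_set (nbrs e x).

Lemma mem_nb x y : (y \in nb x) = e x y.
Proof.
have : (y \in fset_set (nbrs e x)) = (y \in nbrs e x) by rewrite in_fset_set.
by rewrite /nb => ->; apply/idP/idP => [|exy]; rewrite inE.
Qed.

Lemma uniq_nb x : uniq (nb x).
Proof. exact: fset_uniq. Qed.

Lemma size_nb x : size (nb x) = deg e x.
Proof. by []. Qed.

Lemma size_nb_gt0 x : (0 < size (nb x))%N.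
Proof. by rewrite size_nb. Qed.

(** Transition probability of the simple random walk. *)
Definition step x y : R := if e x y then (deg e x)%:R^-1 else 0.

(** Probability that the walk started at [x] follows the path [s]. *)
Fixpoint weight x s : R :=
  if s is y :: s' then step x y * weight y s' else 1.

Lemma weight_rcons x s y :
  weight x (rcons s y) = weight x s * step (last x s) y.
Proof.
by elim: s x => [|z s IH] x /=; [rewrite mulr1 mul1r | rewrite IH mulrA].
Qed.

(** The paths of length [n] from [x], without their starting point. *)
Fixpoint paths n x : seq (seq V) :=
  if n is n'.+1 then [seq y :: s | y <- nb x, s <- paths n' y] else [:: [::]].

Lemma paths_size n x s : s \in paths n x -> size s = n.
Proof.
elim: n x s => [|n IH] x s /=; first by rewrite inE => /eqP->.
by move=> /allpairsPdep[y [t [_ tp ->]]] /=; rewrite (IH _ _ tp).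
Qed.

Lemma paths_uniq n x : uniq (paths n x).
Proof.
elim: n x => [//|n IH] x /=; apply: allpairs_uniq_dep; first exact: uniq_nb.
  by move=> y _; exact: IH.
by move=> [y s] [z t] _ _ /= [-> ->].
Qed.

Lemma pexp_weight n x f :
  pexp nb n x f = \sum_(s <- paths n x) weight x s * f s.
Proof.
elim: n x f => [|n IH] x f /=; first by rewrite big_seq1 mul1r.
rewrite big_allpairs_dep /= mulr_sumr big_seq [RHS]big_seq.
apply: eq_bigr => y; rewrite mem_nb => exy; rewrite IH mulr_sumr.
by apply: eq_bigr => s _; rewrite /step exy size_nb mulrA.
Qed.

Lemma weight_total n x : \sum_(s <- paths n x) weight x s = 1.
Proof.
rewrite -(pexp_cst size_nb_gt0 n x 1) pexp_weight.
by apply: eq_bigr => s _; rewrite mulr1.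
Qed.

(** The positions of the walk at times [1], ..., [n]. *)
Definition trajectory n (w : T) : seq V := mkseq (fun i => S i.+1 w) n.

Lemma trajectoryS n w : trajectory n.+1 w = rcons (trajectory n w) (S n.+1 w).
Proof. by rewrite /trajectory mkseqS. Qed.

(** The event that the walk starts at [x] and follows one of the paths of [l]. *)
Definition at_paths n x (l : seq (seq V)) : set T :=
  [set w | S 0%N w = x /\ trajectory n w \in l].

Lemma measurable_at_path n x s : measurable (at_paths n x [:: s]).
Proof.
elim: n s => [|n IH] s.
  case: s => [|y s].
    rewrite (_ : at_paths _ _ _ = [set w | S 0%N w = x]).
      exact: (srw_measurable walkS).
    by apply/seteqP; split => [w []//|w h]; split => //; rewrite inE.
  by rewrite (_ : at_paths _ _ _ = set0) // -subset0 => w [] _; rewrite inE.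
case/lastP: s => [|s y].
  rewrite (_ : at_paths _ _ _ = set0) // -subset0 => w [] _.
  by rewrite inE trajectoryS => /eqP; case: trajectory.
rewrite (_ : at_paths _ _ _ = at_paths n x [:: s] `&` [set w | S n.+1 w = y]).
  by apply: measurableI => //; exact: (srw_measurable walkS).
apply/seteqP; split => w.
  by move=> [h]; rewrite inE trajectoryS eqseq_rcons => /andP[/eqP h1 /eqP h2];
    split => //; split => //; rewrite inE h1.
move=> [[h]]; rewrite inE => /eqP h1 h2; split => //.
by rewrite inE trajectoryS h1 h2.
Qed.

Lemma at_pathE n x s : size s = n ->
  at_paths n x [:: s] =
  [set w | forall i, (i <= n)%N -> S i w = nth x (x :: s) i].
Proof.
move=> sn; apply/seteqP; split => w /=.
  move=> [h0]; rewrite inE => /eqP hs [|i] //= ilt.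
  by rewrite -hs nth_mkseq.
move=> h; split; first exact: (h 0%N).
rewrite inE; apply/eqP; apply: (@eq_from_nth _ x); rewrite size_mkseq //.
by move=> i ilt; rewrite nth_mkseq // (h i.+1).
Qed.

Lemma law_path n x s : size s = n ->
  P x (at_paths n x [:: s]) = (weight x s)%:E.
Proof.
elim: n s => [|n IH] s.
  move=> /size0nil ->; rewrite (_ : at_paths _ _ _ = [set w | S 0%N w = x]).
    exact: (srw_start walkS).
  by apply/seteqP; split => [w []//|w h]; split => //; rewrite inE.
case/lastP: s => // s y; rewrite size_rcons => -[sn].
rewrite at_pathE ?size_rcons ?sn //.
have := srw_step walkS x n (nth x (x :: s)) y.
rewrite -at_pathE // IH // (_ : nth x (x :: s) n = last x s); last first.
  by rewrite (last_nth x) sn.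
rewrite weight_rcons EFinM => <-; congr (P x _).
apply/seteqP; split => w /= h.
  split.
    move=> i ile; rewrite h; last exact: leqW.
    by rewrite -rcons_cons nth_rcons /= sn ltnS ile.
  by rewrite h // -rcons_cons nth_rcons /= sn ltnn eqxx.
case: h => h hy i; rewrite leq_eqVlt => /orP[/eqP->|il].
  by rewrite hy -rcons_cons nth_rcons /= sn ltnn eqxx.
by rewrite h // -rcons_cons nth_rcons /= sn il.
Qed.

Lemma at_paths_cons n x s l :
  at_paths n x (s :: l) = at_paths n x [:: s] `|` at_paths n x l.
Proof.
apply/seteqP; split => w /=.
  move=> [h]; rewrite inE => /orP[h1|h1]; [left|right]; split => //.
  by rewrite inE.
by move=> [[h]|[h h1]]; [rewrite inE|]; move=> *; split => //; rewrite inE;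
  apply/orP; [left|right].
Qed.

Lemma measurable_at_paths n x l : measurable (at_paths n x l).
Proof.
elim: l => [|s l IH].
  by rewrite (_ : at_paths _ _ _ = set0) // -subset0 => w [].
by rewrite at_paths_cons; apply: measurableU => //; exact: measurable_at_path.
Qed.

Lemma law_paths n x l : uniq l -> (forall s, s \in l -> size s = n) ->
  P x (at_paths n x l) = (\sum_(s <- l) weight x s)%:E.
Proof.
elim: l => [_ _|s l IH /= /andP[sl ul] sz].
  rewrite (_ : at_paths _ _ _ = set0) ?measure0 ?big_nil //.
  by rewrite -subset0 => w [].
have dj : at_paths n x [:: s] `&` at_paths n x l = set0.
  rewrite -subset0 => w [[_ ws] [_ wl]]; move: ws wl; rewrite inE => /eqP ->.
  by rewrite (negbTE sl).
have m1 := measurable_at_path n x s; have m2 := measurable_at_paths n x l.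
rewrite at_paths_cons big_cons EFinD measureU //=.
congr (_ + _)%E; first by apply: law_path; rewrite sz ?mem_head.
by apply: IH => // t tl; rewrite sz // inE tl orbT.
Qed.

Lemma law_all n x : P x (at_paths n x (paths n x)) = 1%:E.
Proof.
rewrite law_paths ?paths_uniq ?weight_total //.
by move=> s; exact: paths_size.
Qed.

(** The probability of an event that depends on the first [n] steps only. *)
Lemma law_event n x (D : pred (seq V)) (B : set T) : measurable B ->
  (forall w, S 0%N w = x -> B w <-> D (trajectory n w)) ->
  P x B = (pexp nb n x (fun s => (D s)%:R))%:E.
Proof.
move=> mB BD; pose A := at_paths n x (paths n x).
have mA : measurable A by exact: measurable_at_paths.
have PB : P x B = P x (B `&` A).
  rewrite [LHS](measureDI (P x) mB mA) [X in (X + _)%E](_ : _ = 0%E) ?add0e //.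
  apply/eqP; rewrite eq_le measure_ge0 andbT.
  apply: (@le_trans _ _ (P x (~` A))).
    by apply: le_measure; rewrite ?inE; [exact: measurableD|exact: measurableC|
      move=> w []].
  by rewrite probability_setC // law_all subee.
have -> : P x B = P x (at_paths n x [seq s <- paths n x | D s]).
  rewrite PB; congr (P x _); apply/seteqP; split => w.
    move=> [Bw [h0 hp]]; split => //; rewrite mem_filter hp andbT.
    exact/BD.
  move=> [h0]; rewrite mem_filter => /andP[hD hp]; split => //.
  exact/BD.
rewrite law_paths ?filter_uniq ?paths_uniq //; last first.
  by move=> s; rewrite mem_filter => /andP[_]; exact: paths_size.
rewrite pexp_weight big_filter big_mkcond; congr EFin; apply: eq_bigr => s _.
by case: (D s); rewrite ?mulr1 ?mulr0.
Qed.

(** The event that the path satisfies an arbitrary predicate [D] has a measurable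
    cover [B] of the right probability, also when [V] is uncountable and the
    event is not known to be measurable. *)
Lemma law_cover n x (D : pred (seq V)) : exists B : set T,
  [/\ measurable B, P x B = (pexp nb n x (fun s => (D s)%:R))%:E &
      forall w, ~ B w -> S 0%N w = x /\ ~~ D (trajectory n w)].
Proof.
pose l := [seq s <- paths n x | ~~ D s]; pose A := at_paths n x l.
have mA : measurable A by exact: measurable_at_paths.
exists (~` A); split; first exact: measurableC.
  have sz s : s \in l -> size s = n.
    by rewrite mem_filter => /andP[_]; exact: paths_size.
  rewrite probability_setC // /A law_paths ?filter_uniq ?paths_uniq //.
  rewrite -EFinB -[X in X - _](weight_total n x) pexp_weight.
  rewrite big_filter [X in _ - X]big_mkcond -sumrB; congr EFin.
  by apply: eq_bigr => s _; case: (D s); rewrite ?subr0 ?mulr1 ?subrr ?mulr0.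
move=> w /contrapT [h0]; rewrite mem_filter => /andP[hD _]; split => //.
Qed.

Lemma heat_kernelE n x y : heat_kernel P S n x y = trans R nb n x y.
Proof.
rewrite /heat_kernel (@law_event n x (fun s => last x s == y)) //.
  exact: (srw_measurable walkS).
move=> w h0; rewrite /= -h0; case: n => [|n]; first by split=> /eqP.
by rewrite trajectoryS last_rcons; split => /eqP.
Qed.

Lemma return_timeE n x :
  [set w | (n%:R%:E < return_time R S x w)%E] =
  \bigcap_(k in [set k | (0 < k <= n)%N]) ~` [set w | S k w = x].
Proof.
apply/seteqP; split => w /=.
  move=> h k /= /andP[k0 kn] Sk; move: h; rewrite ltNge => /negP; apply.
  apply: (@le_trans _ _ (k%:R)%:E); last by rewrite lee_fin ler_nat.
  by apply: ereal_inf_lbound; exists k.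
move=> h; apply: (@lt_le_trans _ _ (n.+1%:R)%:E).
  by rewrite lte_fin ltr_nat.
apply: le_ereal_inf_tmp => _ [k [k0 Sk] <-]; rewrite lee_fin ler_nat ltnNge.
by apply/negP => kn; apply: (h k) => //=; rewrite k0.
Qed.

Lemma law_return_time n x :
  P x [set w | (n%:R%:E < return_time R S x w)%E] = (esc R nb n x)%:E.
Proof.
rewrite return_timeE (@law_event n x (fun s => x \notin s)) //.
  by apply: bigcap_measurableType => k _; apply: measurableC;
    exact: (srw_measurable walkS).
move=> w _; split.
  move=> h; apply/mapP => -[k]; rewrite mem_iota add0n => /andP[_ kn] xk.
  by apply: (h k.+1) => //.
move=> h k /= /andP[]; case: k => // k _ kn Sk; move: h => /negP; apply.
by apply/mapP; exists k; rewrite ?mem_iota.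
Qed.

Lemma walk_range_ge n a w : (a <= n)%N ->
  (size (undup (trajectory a w)) <= walk_range S n w)%N.
Proof.
move=> an; rewrite /walk_range.
have fA : finite_set [set S k w | k in [set k : nat | (k <= n)%N]].
  by apply: finite_image; apply: sub_finite_set (finite_II n.+1) => k /=.
apply: (uniq_leq_size (undup_uniq _)) => y; rewrite mem_undup => /mapP[k].
rewrite mem_iota add0n => /andP[_ ka] ->.
have : S k.+1 w \in fset_set [set S k w | k in [set k : nat | (k <= n)%N]].
  by rewrite in_fset_set // inE; exists k.+1 => //=; apply: leq_trans an.
by [].
Qed.

End LawOfWalk.

(** * Limits inferior, Borel-Cantelli, and bounds from the geometry *)

Section Limits.
Set Implicit Arguments.
Unset Strict Implicit.
Unset Printing Implicit Defensive.
Variable R : realType.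

Lemma limn_einf_sup_einfs (u : (\bar R)^nat) :
  limn_einf u = ereal_sup (range (einfs u)).
Proof. by rewrite limn_einf_lim; apply/cvg_lim => //; exact: cvg_einfs_sup. Qed.

Lemma lt_limn_einf (u : (\bar R)^nat) (a : \bar R) :
  (a < limn_einf u)%E -> \forall n \near \oo, (a < u n)%E.
Proof.
rewrite limn_einf_sup_einfs => /ereal_sup_gt[_ [n _ <-]] an.
exists n => // k /= nk; apply: lt_le_trans an _.
by apply: ereal_inf_lbound; exists k.
Qed.

Lemma le_limn_einf (u : (\bar R)^nat) (a : \bar R) :
  (\forall n \near \oo, (a <= u n)%E) -> (a <= limn_einf u)%E.
Proof.
move=> [n _ h]; rewrite limn_einf_sup_einfs.
apply: (@le_trans _ _ (einfs u n)); last first.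
  by apply: ereal_sup_ubound; exists n.
by apply: le_ereal_inf_tmp => _ [k /= nk <-]; exact: h.
Qed.

Lemma rat_le_ereal (x y : \bar R) : (0 <= y)%E ->
  (forall q : rat, 0 < (ratr q : R) -> ((ratr q : R)%:E < x)%E ->
    ((ratr q : R)%:E <= y)%E) -> (x <= y)%E.
Proof.
move=> y0 H; rewrite leNgt; apply/negP => yx.
have [l ly] : exists l, y = l%:E.
  by case: y y0 yx {H} => [l|//|//] _; [exists l | case: x].
rewrite ly lee_fin in y0.
have [u lu ux] : exists2 u : R, l < u & (u%:E <= x)%E.
  rewrite ly in yx; case: x yx {H} => [v|_|//].
    by rewrite lte_fin => lv; exists v.
  by exists (l + 1); rewrite ?ltrDl ?leey.
have [q] := rat_in_itvoo lu; rewrite in_itv /= => /andP[lq qu].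
have : ((ratr q : R)%:E <= y)%E.
  apply: H; first exact: le_lt_trans lq.
  by apply: lt_le_trans ux; rewrite lte_fin.
by rewrite ly lee_fin leNgt lq.
Qed.

Lemma sum_inv_sqr n : \sum_(0 <= k < n) (k.+1%:R ^+ 2)^-1 <= 2 :> R.
Proof.
suff h : \sum_(0 <= k < n.+1) (k.+1%:R ^+ 2)^-1 <= 2 - n.+1%:R^-1 :> R.
  apply: (@le_trans _ _ (2 - n.+1%:R^-1)); last by rewrite gerBl invr_ge0.
  apply: le_trans h; rewrite [leRHS]big_nat_recr //= lerDl.
  by rewrite invr_ge0 exprn_ge0.
elim: n => [|n IH]; first by rewrite big_nat1 expr1n invr1; lra.
rewrite big_nat_recr //=; apply: le_trans (lerD IH (lexx _)) _.
have -> : n.+2%:R = n.+1%:R + 1 :> R by rewrite natr1.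
have : 0 < n.+1%:R :> R by [].
move: (n.+1%:R : R) => a a0.
rewrite -lerBrDr -subr_ge0.
have -> : 2 - (a + 1)^-1 - ((a + 1) ^+ 2)^-1 - (2 - a^-1) =
  (a * (a + 1) ^+ 2)^-1.
  by field; rewrite !gt_eqF ?addr_gt0.
by rewrite invr_ge0 mulr_ge0 ?exprn_ge0 ?addr_ge0 // ltW.
Qed.

Lemma borel_cantelli_sqr (disp : measure_display) (T : measurableType disp)
    (mu : {measure set T -> \bar R}) (A : nat -> set T) (D : R) :
  (forall j, measurable (A j)) ->
  (\forall j \near \oo, (mu (A j) <= (D / j%:R ^+ 2)%:E)%E) ->
  {ae mu, forall w, \forall j \near \oo, ~ A j w}.
Proof.
move=> mA [J _ HJ]; pose F k := A (J + k.+1)%N.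
have D0 : 0 <= D.
  have := le_trans (measure_ge0 mu _) (HJ J.+1 (leqnSn _)).
  by rewrite lee_fin pmulr_lge0 // invr_gt0 exprn_gt0.
have F0 : mu (lim_sup_set F) = 0%E.
  apply: lim_sup_set_cvg0 => [k|]; first exact: mA.
  apply: (@le_lt_trans _ _ (D * 2)%:E); last exact: ltry.
  apply: lime_le.
    by apply: is_cvg_nneseries => n _ _; exact: measure_ge0.
  apply: nearW => n; apply: (@le_trans _ _
      (\sum_(0 <= k < n) (D / k.+1%:R ^+ 2)%:E)%E).
    apply: lee_sum => k _; apply: le_trans (HJ _ _) _ => /=; first lia.
    rewrite lee_fin ler_wpM2l // lef_pV2 ?posrE ?exprn_gt0 ?ltr0n //; last lia.
    by rewrite lerXn2r ?nnegrE // ler_nat; lia.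
  rewrite sumEFin lee_fin -mulr_sumr ler_wpM2l //; exact: sum_inv_sqr.
exists (lim_sup_set F); split => //.
  apply: bigcap_measurableType => n _; apply: bigcup_measurable => k _.
  exact: mA.
move=> w /= nw n _; apply: contrapT => h; apply: nw.
exists (J + n.+1)%N => // j /= hj Aj; apply: h.
exists (j - J.+1)%N => /=; first lia.
by rewrite /F (_ : (J + (j - J.+1).+1 = j)%N) //; lia.
Qed.

End Limits.

Section GraphBounds.
Set Implicit Arguments.
Unset Strict Implicit.
Unset Printing Implicit Defensive.

Variables (R : realType) (V : choiceType) (e : rel V).

Lemma connected_deg_gt0 : infinite_set [set: V] -> connected_graph e ->
  (forall x, finite_set (nbrs e x)) -> forall x, (0 < deg e x)%N.
Proof.
move=> Vinf conn fin x.
have [y yx] : exists y, y <> x.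
  apply: contrapT => h; apply: Vinf; apply: sub_finite_set (finite_set1 x).
  by move=> y _; apply: contrapT => yx; apply: h; exists y.
have [k [[|z p] [/= pe pl _]]] := conn x y; first by case: yx.
case/andP: pe => exz _.
have : z \in fset_set (nbrs e x) by rewrite in_fset_set // inE.
rewrite /deg; case: (fset_set (nbrs e x)) => -[//|a l] i _; exact: ltn0Sn.
Qed.

(** Distances are integers. *)
Lemma gvol_trunc x (r : R) : 0 <= r ->
  gvol e x r = gvol e x ((Num.truncn r)%:R : R).
Proof.
move=> r0; rewrite /gvol; congr (#|` fset_set _|)%fset.
apply/seteqP; split => y /=; rewrite /gball /= ler_nat truncn_ge_nat //.
Qed.

Variables (disp : measure_display) (T : measurableType disp).
Variables (P : V -> probability T R) (S : nat -> T -> V) (d : R).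

(** On an Ahlfors regular graph whose walk dimension is the volume exponent, the
    volume factor alone gives [p_n(x, y) <= C / n]. *)
Lemma heat_kernel_le : 1 < d -> ahlfors_regular e d ->
  sub_gaussian_upper e P S d ->
  exists2 C : R, 0 < C &
    forall n x y, (0 < n)%N -> heat_kernel P S n x y <= C / n%:R.
Proof.
move=> d1 [c1 [c2 [c10 c20 Hvol]]] [c3 [c4 [c30 c40 Hker]]].
have d0 : 0 < d by lra.
have p0 : 0 < 2 `^ d :> R by rewrite powR_gt0.
exists (c3 * 2 `^ d / c1); first by rewrite divr_gt0 ?mulr_gt0.
move=> n x y n0; have n0R : 0 < n%:R :> R by rewrite ltr0n.
apply: le_trans (Hker n x y n0) _.
set r : R := n%:R `^ d^-1; set k := Num.truncn r.
have r1 : 1 <= r.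
  have {1}-> : 1 = 1 `^ d^-1 :> R by rewrite powR1.
  by rewrite ge0_ler_powR ?nnegrE ?invr_ge0 ?ler1n // ltW.
have k1 : (0 < k)%N by rewrite truncn_gt0.
have rk : r <= 2 * k%:R.
  have := truncnS_gt r; rewrite -/k -natr1.
  have : 1 <= k%:R :> R by rewrite ler1n.
  lra.
rewrite gvol_trunc ?(le_trans _ r1) // -/k.
have /andP[vk _] := Hvol k x k1.
have nk : n%:R <= 2 `^ d * k%:R `^ d.
  have {1}-> : n%:R = r `^ d by rewrite -powRrM mulVf ?gt_eqF // powRr1.
  rewrite -powRM // ge0_ler_powR ?nnegrE ?mulr_ge0 ?(ltW d0) //.
  exact: le_trans ler01 r1.
have kd0 : 0 < k%:R `^ d :> R by rewrite powR_gt0 // ltr0n.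
have v0 : 0 < (gvol e x (k%:R : R))%:R :> R.
  by apply: lt_le_trans vk; rewrite mulr_gt0.
apply: (@le_trans _ _ (c3 / (gvol e x (k%:R : R))%:R)).
  rewrite ler_piMr ?divr_ge0 ?(ltW c30) // -[leRHS]expR0 ler_expR.
  by rewrite mulNr oppr_le0 mulr_ge0 ?(ltW c40) ?divr_ge0 ?powR_ge0.
rewrite ler_pdivrMr //; set v := (gvol _ _ _)%:R in vk v0 *.
have -> : c3 * 2 `^ d / c1 / n%:R * v = c3 * (2 `^ d * v / (c1 * n%:R)).
  by field; rewrite !gt_eqF.
rewrite ler_peMr ?(ltW c30) // ler_pdivlMr ?mulr_gt0 // mul1r.
apply: le_trans (ler_wpM2l (ltW c10) nk) _.
by rewrite mulrCA ler_pM2l.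
Qed.


End GraphBounds.

(** * The lower bound on the range *)

Section RangeLowerBound.
Set Implicit Arguments.
Unset Strict Implicit.
Unset Printing Implicit Defensive.

(** Every integer [n >= M] lies between [L] and [L.+1] blocks of length [2 ^ j],
    with [L] between [M] and [2 * M]. *)
Lemma dyadic_blocks M n : (0 < M)%N -> (M <= n)%N ->
  exists L, let j := trunc_log 2 (n %/ M) in
  [/\ (M <= L)%N, (L <= 2 * M)%N, (L * 2 ^ j <= n)%N & (n <= L.+1 * 2 ^ j)%N].
Proof.
move=> M0 Mn; set j := trunc_log 2 (n %/ M).
have q0 : (0 < n %/ M)%N by rewrite divn_gt0.
have h1 : (2 ^ j <= n %/ M)%N by apply: trunc_logP.
have h2 : (n %/ M < 2 ^ j.+1)%N by apply: trunc_log_ltn.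
have b0 : (0 < 2 ^ j)%N by rewrite expn_gt0.
exists (n %/ 2 ^ j)%N; split.
- by rewrite leq_divRL // mulnC -leq_divRL.
- rewrite -ltnS ltn_divLR // (leq_trans (n := (2 ^ j.+1 * M)%N)) -?ltn_divLR //.
  by rewrite expnS mulnAC leq_mul2r leqnSn orbT.
- exact: leq_trunc_div.
- by rewrite ltnW // ltn_ceil.
Qed.

Variables (R : realType) (V : choiceType) (e : rel V).
Variables (disp : measure_display) (T : measurableType disp).
Variables (P : V -> probability T R) (S : nat -> T -> V).
Hypothesis nbrs_finite : forall x, finite_set (nbrs e x).
Hypothesis deg_gt0 : forall x, (0 < deg e x)%N.
Hypothesis walkS : simple_random_walk e P S.

Variables (c C r : R).
Hypotheses (c_gt0 : 0 < c) (C_gt0 : 0 < C).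
Hypothesis kernel_le : forall n x y, (0 < n)%N ->
  heat_kernel P S n x y <= C / n%:R.
Hypothesis kernel_ge : forall n x, (0 < n)%N ->
  c <= n%:R * (heat_kernel P S n x x + heat_kernel P S n.+1 x x).
Hypothesis esc_log : \forall n \near \oo, forall x,
  r <= ln n%:R * esc R (nb e) n x.

(** At scale [2 ^ j], at most three of the first [l] blocks are bad, for all
    large [j]: four bad blocks have a probability of order
    [(gap j / j) ^ 4 <= 36 ^ 2 / j ^ 2], which is summable. *)
Lemma eventually_few_bad (eps rho : R) (l : nat) x : 0 < eps -> 0 <= rho ->
  {ae P x, forall w, \forall j \near \oo,
    (nbad (2 ^ j) (rho * ((2 ^ j)%:R / j%:R))
       ((r / ln 2 - 3 * eps) * ((2 ^ j)%:R / j%:R)) l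
       (trajectory S (l * 2 ^ j) w) <= 3)%N}.
Proof.
move=> eps0 rho0.
have tle n y z : (0 < n)%N -> trans R (nb e) n y z <= C / n%:R.
  by move=> n0; rewrite -(heat_kernelE nbrs_finite deg_gt0 walkS) kernel_le.
have tge n y : (0 < n)%N ->
    c <= n%:R * (trans R (nb e) n y y + trans R (nb e) n.+1 y y).
  by move=> n0; rewrite -!(heat_kernelE nbrs_finite deg_gt0 walkS) kernel_ge.
have szN := size_nb_gt0 deg_gt0.
have [D D0 [J _ HD]] := dyadic_block szN c_gt0 C_gt0 tle tge esc_log
  eps0 rho0.
pose bads j (s : seq V) := nbad (2 ^ j) (rho * ((2 ^ j)%:R / j%:R))
  ((r / ln 2 - 3 * eps) * ((2 ^ j)%:R / j%:R)) l s.
have /choice[A HA] j := law_cover nbrs_finite deg_gt0 walkS (l * 2 ^ j) x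
  (fun s => (4 <= bads j s)%N).
have : {ae P x, forall w, \forall j \near \oo, ~ A j w}.
  apply: (@borel_cantelli_sqr _ _ _ _ _ ((l%:R * D) ^+ 4 * 36 ^+ 2)).
    by move=> j; have [] := HA j.
  exists J.+1 => // j /= Jj; have [_ -> _] := HA j; rewrite lee_fin.
  have j0 : (0 < j)%N by exact: leq_ltn_trans Jj.
  have j0R : 0 < j%:R :> R by rewrite ltr0n.
  have p0 : 0 <= D * ((gap j)%:R / j%:R) by rewrite mulr_ge0 ?divr_ge0.
  apply: le_trans (nbad_tail szN p0 (HD j (ltnW Jj)) l 4 x) _.
  have -> : (l%:R * (D * ((gap j)%:R / j%:R))) ^+ 4 =
    (l%:R * D) ^+ 4 * ((gap j)%:R ^+ 2 / j%:R) ^+ 2 / j%:R ^+ 2.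
    by field; rewrite gt_eqF.
  rewrite ler_pM2r ?invr_gt0 ?exprn_gt0 // ler_wpM2l ?exprn_ge0 ?mulr_ge0 //.
  rewrite lerXn2r ?nnegrE ?divr_ge0 ?exprn_ge0 //.
  by rewrite ler_pdivrMr // -natrX -natrM ler_nat gap_sqr.
apply: filterS => w; apply: filterS => j; have [_ _ h] := HA j.
by move=> /h[_]; rewrite -ltnNge.
Qed.

Lemma range_ge (a : R) x : 0 < a -> a < r ->
  {ae P x, forall w, \forall n \near \oo,
    a <= (walk_range S n w)%:R / (n%:R / ln n%:R)}.
Proof.
move=> a0 ar; have l20 := ln2_gt0 R.
pose sigma := a / ln 2; pose tau := (r / ln 2 + sigma) / 2.
pose eps := (r / ln 2 - sigma) / 6.
have s0 : 0 < sigma by rewrite divr_gt0.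
have sr : sigma < r / ln 2 by rewrite ltr_pM2r ?invr_gt0.
have eps0 : 0 < eps by rewrite /eps; lra.
have st : sigma < tau by rewrite /tau; lra.
have tauE : r / ln 2 - 3 * eps = tau by rewrite /eps /tau; lra.
have aE : a = sigma * ln 2 by rewrite /sigma divfK ?gt_eqF.
(* [M] is so large that losing three blocks and rounding [n] up to the next
   block cost less than the margin between [tau] and [sigma] *)
pose M := (Num.truncn ((3 * tau + sigma) / (tau - sigma))).+1.
have MP L : (M <= L)%N -> L.+1%:R * sigma <= (L%:R - 3) * tau.
  move=> ML; have : M%:R <= L%:R :> R by rewrite ler_nat.
  have := truncnS_gt ((3 * tau + sigma) / (tau - sigma)); rewrite -/M => h1 h2.
  have := le_trans (ltW h1) h2; rewrite ler_pdivrMr ?subr_gt0 // -natr1.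
  lra.
have M0 : (0 < M)%N by [].
pose l := (2 * M)%N; pose rho := l%:R * tau.
have tau0 : 0 < tau by lra.
have rho0 : 0 <= rho by rewrite mulr_ge0 // ltW.
have := eventually_few_bad l x eps0 rho0.
apply: filterS => w [J _ HJ].
exists (M * 2 ^ J.+1)%N => // n /= hn.
have p0 : (0 < 2 ^ J.+1)%N by rewrite expn_gt0.
have Mn : (M <= n)%N by apply: leq_trans hn; rewrite leq_pmulr.
have [L] := dyadic_blocks M0 Mn; set j := trunc_log 2 (n %/ M).
move=> [ML LM Ln nL].
have Jj : (J < j)%N.
  by apply: trunc_log_max => //; rewrite leq_divRL // mulnC.
have j0 : (0 < j)%N by exact: leq_ltn_trans Jj.
have := HJ j (ltnW Jj); rewrite tauE.
set b := (2 ^ j)%N in Ln nL *; set tr := trajectory _ _ _ => few.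
have b0 : (0 < b)%N by rewrite expn_gt0.
have n0 : (0 < n)%N by apply: leq_trans Mn.
have j0R : 0 < j%:R :> R by rewrite ltr0n.
have b0R : 0 < b%:R :> R by rewrite ltr0n.
have n0R : 0 < n%:R :> R by rewrite ltr0n.
have bj0 : 0 <= b%:R / j%:R :> R by rewrite divr_ge0.
have tb0 : 0 <= tau * (b%:R / j%:R) by rewrite mulr_ge0 // ltW.
have range : (L%:R - 3) * (tau * (b%:R / j%:R)) <= (walk_range S n w)%:R.
  have sz : (L * b <= size tr)%N by rewrite size_mkseq leq_mul2r LM orbT.
  apply: (le_trans (nbad_range tb0 _ LM sz few)); first by rewrite mulrA.
  rewrite ler_nat (_ : take (L * b) tr = trajectory S (L * b) w).
    exact: walk_range_ge.
  rewrite /tr /trajectory /mkseq -map_take take_iota.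
  by rewrite (minn_idPl _) // leq_mul2r LM orbT.
have lnb : j%:R * ln 2 <= ln n%:R :> R.
  rewrite -(ln_pow2 R) ler_ln ?posrE ?ltr0n // ler_nat.
  by apply: leq_trans Ln; rewrite leq_pmull // (leq_trans M0 ML).
have ln0 : 0 < ln n%:R :> R by apply: lt_le_trans lnb; rewrite mulr_gt0.
rewrite invf_div mulrA ler_pdivlMr //.
have nLR : n%:R <= L.+1%:R * b%:R :> R by rewrite -natrM ler_nat.
have L3 := MP L ML.
apply: (@le_trans _ _ (a * (L.+1%:R * b%:R))).
  by rewrite ler_pM2l.
apply: (@le_trans _ _ ((L%:R - 3) * (tau * (b%:R / j%:R)) * (j%:R * ln 2))).
  have -> : (L%:R - 3) * (tau * (b%:R / j%:R)) * (j%:R * ln 2) =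
    ((L%:R - 3) * tau) * (b%:R * ln 2) by field; rewrite gt_eqF.
  rewrite aE (_ : _ * _ = (L.+1%:R * sigma) * (b%:R * ln 2)); last by ring.
  by rewrite ler_pM2r // mulr_gt0.
have L30 : 0 <= (L%:R - 3) * (tau * (b%:R / j%:R)).
  rewrite mulrA mulr_ge0 //; apply: le_trans L3; rewrite mulr_ge0 // ltW //.
apply: ler_pM => //; first by rewrite ltW // mulr_gt0.
Qed.

End RangeLowerBound.

Theorem theorem1p4 (R : realType) (V : choiceType) (e : rel V)
    (disp : measure_display) (T : measurableType disp)
    (P : V -> probability T R) (S : nat -> T -> V) (d : R) :
  symmetric e -> irreflexive e ->
  infinite_set [set: V] -> connected_graph e -> bounded_degree e ->
  simple_random_walk e P S ->
  uniformly_weakly_recurrent P S ->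
  1 < d -> ahlfors_regular e d -> sub_gaussian_upper e P S d ->
  forall x : V,
    {ae P x, forall w : T,
      (r_inf P S <=
       limn_einf (fun n : nat =>
         ((walk_range S n w)%:R / (n%:R / ln n%:R))%:E))%E}.
Proof.
move=> _ _ Vinf conn [D HD] walkS [c [C [c0 _ Hrec]]] d1 ahl sub x.
have fin y : finite_set (nbrs e y) by have [] := HD y.
have dg := connected_deg_gt0 Vinf conn fin.
have [C' C'0 kle] := heat_kernel_le d1 ahl sub.
have kge n y : (0 < n)%N ->
    c <= n%:R * (heat_kernel P S n y y + heat_kernel P S n.+1 y y).
  by move=> n0; have /andP[] := Hrec n y n0.
have escq (q : R) : (q%:E < r_inf P S)%E -> \forall n \near \oo, forall y,
    q <= ln n%:R * esc R (nb e) n y.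
  move=> /lt_limn_einf; move=> [n0 _ Hn]; exists n0.+1 => // n /= hn y.
  have := Hn n (ltnW hn); rewrite /= => /ltW h.
  rewrite -lee_fin; apply: le_trans h _; rewrite EFinM.
  apply: lee_wpmul2l; first by rewrite lee_fin ln_ge0 // ler1n; lia.
  rewrite -(law_return_time fin dg walkS); apply: ereal_inf_lbound.
  by exists y.
(* almost surely, the bound holds for all positive rationals below [r_inf] *)
have all_q : {ae P x, forall w, forall k : nat, forall q : rat,
    choice.unpickle k = Some q -> 0 < (ratr q : R) ->
    ((ratr q : R)%:E < r_inf P S)%E ->
    ((ratr q : R)%:E <= limn_einf (fun n : nat =>
         ((walk_range S n w)%:R / (n%:R / ln n%:R))%:E))%E}.
  apply: ae_foralln => k; case: (choice.unpickle k) => [q|]; last first.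
    by apply: aeW => w q.
  have [[q0 qr]|nq] := pselect (0 < (ratr q : R) /\
    ((ratr q : R)%:E < r_inf P S)%E); last first.
    by apply: aeW => w q' [<-] h1 h2; case: nq.
  have [b qb br] : exists2 b : R, ratr q < b & (b%:E < r_inf P S)%E.
    case: (r_inf P S) qr => [v|_|//].
      rewrite lte_fin => qv; exists ((ratr q + v) / 2); rewrite ?lte_fin; lra.
    by exists (ratr q + 1); rewrite ?ltrDl ?ltry.
  have := range_ge fin dg walkS c0 C'0 kle kge (escq _ br) x q0 qb.
  apply: filterS => w Hw q' [<-] _ _; apply: le_limn_einf.
  by apply: filterS Hw => n; rewrite lee_fin.
apply: filterS all_q => w Hw; apply: rat_le_ereal.
  apply: le_limn_einf; exists 1%N => // n /= n1.
  by rewrite lee_fin !divr_ge0 ?ln_ge0 ?ler1n.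
by move=> q; apply: (Hw (choice.pickle q)); rewrite choice.pickleK.
Qed.
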